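(* Every quaternionic entire function, i.e. every function $f:\mathbb{H}\to\mathbb{H}$ that is the sum of a power series $\sum_{n\in\mathbb{N}}q^na_n$ ($a_n\in\mathbb{H}$) converging in all of $\mathbb{H}$, is quaternionic analytic in $\mathbb{H}$.
   Context: $\mathbb{H}$ is the skew field of real quaternions with Euclidean modulus $|q|$. The regular multiplication $*$ of polynomials/power series with right coefficients is $\left(\sum_n q^n a_n\right)*\left(\sum_n q^n b_n\right)=\sum_n q^n\sum_{k=0}^n a_kb_{n-k}$, and for $p\in\mathbb{H}$, $(q-p)^{*n}$ is the $n$-th power of $q-p$ with respect to $*$ (with $(q-p)^{*0}=1$), evaluated at $q$. For $\Omega\subseteq\mathbb{H}$ (Euclidean) open, $f:\Omega\to\mathbb{H}$ is quaternionic analytic at $p\in\Omega$ if there exist a (Euclidean) neighborhood $U$ of $p$ in $\Omega$ and a series $\sum_n(q-p)^{*n}b_n$ ($b_n\in\mathbb{H}$) converging in $U$ such that $f(q)=\sum_n(q-p)^{*n}b_n$ for all $q\in U$; $f$ is quaternionic analytic in $\Omega$ if it is so at all $p\in\Omega$. *)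

(* Defs.v *)
From HB Require Import structures.
From mathcomp Require Import all_boot all_order all_algebra.
From mathcomp Require Import ring lra.
From mathcomp Require Import all_classical all_reals all_analysis.

Set Implicit Arguments.
Unset Strict Implicit.
Unset Printing Implicit Defensive.

Import Order.TTheory GRing.Theory Num.Theory.
Import numFieldNormedType.Exports.

Local Open Scope classical_set_scope.
Local Open Scope ring_scope.

(* Quat a b c d is the quaternion a + b i + c j + d k. *)
Record quat (R : Type) : Type :=
  Quat { qre : R; qimi : R; qimj : R; qimk : R }.

Section QuatChoice.
Variable R : choiceType.

Definition quat_to (x : quat R) : R * R * R * R :=
  (qre x, qimi x, qimj x, qimk x).
Definition quat_of (u : R * R * R * R) : quat R :=
  let: (a, b, c, d) := u in Quat a b c d.

Lemma quat_toK : cancel quat_to quat_of.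
Proof. by case. Qed.

HB.instance Definition _ := Choice.copy (quat R) (can_type quat_toK).
End QuatChoice.

Section QuatRing.
Variable R : realType.
Implicit Types x y z : quat R.

Definition add_quat x y : quat R :=
  Quat (qre x + qre y) (qimi x + qimi y) (qimj x + qimj y) (qimk x + qimk y).
Definition opp_quat x : quat R :=
  Quat (- qre x) (- qimi x) (- qimj x) (- qimk x).
Definition mul_quat x y : quat R :=
  let: Quat a1 b1 c1 d1 := x in
  let: Quat a2 b2 c2 d2 := y in
  Quat (a1 * a2 - b1 * b2 - c1 * c2 - d1 * d2)
       (a1 * b2 + b1 * a2 + c1 * d2 - d1 * c2)
       (a1 * c2 - b1 * d2 + c1 * a2 + d1 * b2)
       (a1 * d2 + b1 * c2 - c1 * b2 + d1 * a2).
Definition scale_quat (r : R) x : quat R :=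
  Quat (r * qre x) (r * qimi x) (r * qimj x) (r * qimk x).

Lemma add_quatA : associative add_quat.
Proof. by move=> x y z; rewrite /add_quat /= !addrA. Qed.
Lemma add_quatC : commutative add_quat.
Proof. by move=> x y; congr Quat; rewrite addrC. Qed.
Lemma add0_quat : left_id (Quat 0 0 0 0) add_quat.
Proof. by case=> a b c d; rewrite /add_quat /= !add0r. Qed.
Lemma addN_quat : left_inverse (Quat 0 0 0 0) opp_quat add_quat.
Proof. by case=> a b c d; rewrite /add_quat /= !addNr. Qed.

HB.instance Definition _ :=
  GRing.isZmodule.Build (quat R) add_quatA add_quatC add0_quat addN_quat.

Lemma mul_quatA : associative mul_quat.
Proof. by move=> [? ? ? ?] [? ? ? ?] [? ? ? ?]; congr Quat; ring. Qed.
Lemma mul1_quat : left_id (Quat 1 0 0 0) mul_quat.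
Proof. by move=> [? ? ? ?]; congr Quat; ring. Qed.
Lemma mul_quat1 : right_id (Quat 1 0 0 0) mul_quat.
Proof. by move=> [? ? ? ?]; congr Quat; ring. Qed.
Lemma mul_quatDl : left_distributive mul_quat +%R.
Proof.
by move=> [? ? ? ?] [? ? ? ?] [? ? ? ?]; congr Quat; rewrite /=; ring.
Qed.
Lemma mul_quatDr : right_distributive mul_quat +%R.
Proof.
by move=> [? ? ? ?] [? ? ? ?] [? ? ? ?]; congr Quat; rewrite /=; ring.
Qed.
Lemma one_quat_neq0 : Quat 1 0 0 0 != 0 :> quat R.
Proof. by apply/eqP => -[] /eqP; rewrite oner_eq0. Qed.

HB.instance Definition _ := GRing.Zmodule_isNzRing.Build (quat R)
  mul_quatA mul1_quat mul_quat1 mul_quatDl mul_quatDr one_quat_neq0.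

Lemma scale_quatA (a b : R) x :
  scale_quat a (scale_quat b x) = scale_quat (a * b) x.
Proof. by rewrite /scale_quat /= !mulrA. Qed.
Lemma scale1_quat : left_id 1 scale_quat.
Proof. by case=> a b c d; rewrite /scale_quat /= !mul1r. Qed.
Lemma scale_quatDr : right_distributive scale_quat +%R.
Proof. by move=> r x y; congr Quat; rewrite /= mulrDr. Qed.
Lemma scale_quatDl x : {morph scale_quat^~ x : a b / a + b}.
Proof. by move=> r s; congr Quat; rewrite /= mulrDl. Qed.

HB.instance Definition _ := GRing.Zmodule_isLmodule.Build R (quat R)
  scale_quatA scale1_quat scale_quatDr scale_quatDl.

Definition norm_quat x : R :=
  Num.sqrt (qre x ^+ 2 + qimi x ^+ 2 + qimj x ^+ 2 + qimk x ^+ 2).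

Lemma sqr4_ge0 (a b c d : R) : 0 <= a ^+ 2 + b ^+ 2 + c ^+ 2 + d ^+ 2.
Proof. by rewrite !addr_ge0 ?sqr_ge0. Qed.

Lemma cauchy_schwarz4 (a b c d a' b' c' d' : R) :
  a * a' + b * b' + c * c' + d * d' <=
  Num.sqrt (a ^+ 2 + b ^+ 2 + c ^+ 2 + d ^+ 2) *
  Num.sqrt (a' ^+ 2 + b' ^+ 2 + c' ^+ 2 + d' ^+ 2).
Proof.
rewrite -sqrtrM ?sqr4_ge0//; apply: (le_trans (ler_norm _)).
rewrite -sqrtr_sqr ler_wsqrtr// -subr_ge0.
have -> : (a ^+ 2 + b ^+ 2 + c ^+ 2 + d ^+ 2) *
    (a' ^+ 2 + b' ^+ 2 + c' ^+ 2 + d' ^+ 2) -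
    (a * a' + b * b' + c * c' + d * d') ^+ 2 =
    (a * b' - b * a') ^+ 2 + (a * c' - c * a') ^+ 2 +
    (a * d' - d * a') ^+ 2 + (b * c' - c * b') ^+ 2 +
    (b * d' - d * b') ^+ 2 + (c * d' - d * c') ^+ 2 by ring.
by rewrite !addr_ge0 ?sqr_ge0.
Qed.

Lemma ler_norm_quatD x y : norm_quat (x + y) <= norm_quat x + norm_quat y.
Proof.
case: x y => [a b c d] [a' b' c' d'].
rewrite -(@ler_pXn2r _ 2)// ?nnegrE ?addr_ge0 ?sqrtr_ge0//.
rewrite sqrrD !sqr_sqrtr ?sqr4_ge0//=.
have := cauchy_schwarz4 a b c d a' b' c' d'.
rewrite /norm_quat /=; set s := _ * Num.sqrt _ => h.
lra.
Qed.

Lemma norm_quatZ (r : R) x : norm_quat (r *: x) = `|r| * norm_quat x.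
Proof.
rewrite /norm_quat /= !exprMn -!mulrDr sqrtrM ?sqr_ge0//.
by rewrite sqrtr_sqr.
Qed.

Lemma norm_quat0_eq0 x : norm_quat x = 0 -> x = 0.
Proof.
case: x => a b c d /eqP; rewrite sqrtr_eq0 /= => h.
have [[ha hb] [hc hd]] := ((sqr_ge0 a, sqr_ge0 b), (sqr_ge0 c, sqr_ge0 d)).
have sqr0 (t : R) : t ^+ 2 = 0 -> t = 0.
  by move/eqP; rewrite sqrf_eq0 => /eqP.
by congr Quat; apply: sqr0; lra.
Qed.

HB.instance Definition _ := Lmodule_isNormed.Build R (quat R)
  ler_norm_quatD norm_quatZ norm_quat0_eq0.

End QuatRing.

Section Analytic.
Variable R : realType.
Local Notation H := (quat R).

(* The product of {poly H} treats the indeterminate as central, so it is the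
   regular multiplication.  P.[q] would put the coefficients on the left of
   the powers of q; here they are on the right. *)
Definition reval (P : {poly H}) (q : H) : H :=
  \sum_(i < size P) q ^+ i * P`_i.

Definition regular_pow (p : H) (n : nat) (q : H) : H :=
  reval (('X - p%:P) ^+ n) q.

Definition quaternionic_entire (f : H -> H) : Prop :=
  exists a : nat -> H, forall q : H,
    series (fun n => q ^+ n * a n) @ \oo --> f q.

(* A function on Omega is given by any total extension to H: only its values on
   neighborhoods contained in Omega are used. *)
Definition quaternionic_analytic_at (Omega : set H) (f : H -> H) (p : H) :
    Prop :=
  exists U : set H, [/\ nbhs p U, U `<=` Omega &
    exists b : nat -> H, forall q : H, U q ->
      series (fun n => regular_pow p n q * b n) @ \oo --> f q].

Definition quaternionic_analytic (Omega : set H) (f : H -> H) : Prop :=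
  forall p : H, Omega p -> quaternionic_analytic_at Omega f p.

End Analytic.

(* Main.v *)
(* Since the indeterminate is central for the regular product, the binomial
   formula gives q^n = sum_k (q-p)^{*k} C(n,k) p^(n-k).  Substituting it in
   sum_n q^n a_n and exchanging the sums yields the recentered coefficients
   b_k = sum_n C(n,k) p^(n-k) a_n.  The exchange is legitimate for every q
   because |(q-p)^{*k}| <= (|q|+|p|)^k, so that the double series is dominated
   by sum_n (|q|+2|p|)^n |a_n|, which is finite: convergence at a real point
   of twice that size bounds |a_n| geometrically.  Hence the expansion at p
   holds on all of H. *)
Require Import Defs.
From mathcomp Require Import all_boot all_order all_algebra.
From mathcomp Require Import ring lra.
From mathcomp Require Import all_classical all_reals all_analysis.

Set Implicit Arguments.
Unset Strict Implicit.
Unset Printing Implicit Defensive.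

Import Order.TTheory GRing.Theory Num.Theory.
Import numFieldNormedType.Exports.

Local Open Scope classical_set_scope.
Local Open Scope ring_scope.

Section QuatNorm.
Variable R : realType.
Local Notation H := (quat R).
Implicit Types x y : H.

Lemma quat_normE x : `|x| =
  Num.sqrt (qre x ^+ 2 + qimi x ^+ 2 + qimj x ^+ 2 + qimk x ^+ 2).
Proof. by []. Qed.

(** Under the square roots this is Euler's four-square identity. *)
Lemma quat_normM x y : `|x * y| = `|x| * `|y|.
Proof.
case: x y => [a b c d] [a' b' c' d'].
by rewrite !quat_normE /= -sqrtrM ?sqr4_ge0//; congr Num.sqrt; ring.
Qed.

Lemma quat_norm1 : `|1 : H| = 1.
Proof. by rewrite quat_normE /= !expr0n /= !addr0 expr1n sqrtr1. Qed.

Lemma quat_normX x n : `|x ^+ n| = `|x| ^+ n.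
Proof.
by elim: n => [|n IH]; rewrite ?expr0 ?quat_norm1// !exprS quat_normM IH.
Qed.

Lemma quat_norm_coord x :
  [/\ `|qre x| <= `|x|, `|qimi x| <= `|x|, `|qimj x| <= `|x|
    & `|qimk x| <= `|x|].
Proof.
case: x => a b c d; rewrite quat_normE /=.
have := (sqr_ge0 a, sqr_ge0 b, sqr_ge0 c, sqr_ge0 d).
by move=> [[[ha hb] hc] hd]; split; rewrite -sqrtr_sqr ler_wsqrtr//; lra.
Qed.

Lemma quat_cvgMl x (u : nat -> H) (l : H) :
  u @ \oo --> l -> (fun n => x * u n) @ \oo --> x * l.
Proof.
move=> ul; apply/subr_cvg0/norm_cvg0P.
under eq_fun do rewrite -mulrBr quat_normM.
rewrite -(mulr0 `|x|); apply: cvgMl_tmp.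
by apply/norm_cvg0P/subr_cvg0.
Qed.

Lemma quat_basisE x : x = qre x *: Quat 1 0 0 0 + qimi x *: Quat 0 1 0 0
  + qimj x *: Quat 0 0 1 0 + qimk x *: Quat 0 0 0 1.
Proof. by case: x => a b c d; congr Quat => /=; ring. Qed.

(** Each coordinate is additive and bounded by the norm, so its series converges absolutely in [R];
    the four limits are reassembled along 1, i, j, k. *)
Lemma quat_normed_cvg (u : nat -> H) :
  cvgn (series (fun n => `|u n|)) -> cvgn (series u).
Proof.
move=> hu.
have coord_cvg (c : H -> R) : {morph c : x y / x + y} -> c 0 = 0 ->
    (forall x, `|c x| <= `|x|) -> cvgn (fun n => c (series u n)).
  move=> cD c0 cle.
  have -> : (fun n => c (series u n)) = series (c \o u).
    by apply/funext => n; rewrite /series /= (big_morph c cD c0).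
  apply: (@normed_cvg _ R^o); apply: series_le_cvg hu => n //=; exact: cle.
have -> : series u = (fun n => qre (series u n) *: Quat 1 0 0 0)
    + (fun n => qimi (series u n) *: Quat 0 1 0 0)
    + (fun n => qimj (series u n) *: Quat 0 0 1 0)
    + (fun n => qimk (series u n) *: Quat 0 0 0 1).
  by apply/funext => n; rewrite [LHS]quat_basisE.
by repeat apply: is_cvgD; apply: is_cvgZr_tmp; apply: coord_cvg => // x;
  have [] := quat_norm_coord x.
Qed.

End QuatNorm.

Section RegularPower.
Variable R : realType.
Local Notation H := (quat R).
Implicit Types (P : {poly H}) (p q : H).

Lemma reval_widen P q m : (size P <= m)%N ->
  reval P q = \sum_(i < m) q ^+ i * P`_i.
Proof.
move=> le_m; rewrite /reval (big_ord_widen m (fun i => q ^+ i * P`_i))//.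
rewrite big_mkcond; apply: eq_bigr => i _; case: ifPn => //.
by rewrite -leqNgt => /leq_sizeP/(_ _ (leqnn _)) ->; rewrite mulr0.
Qed.

Lemma revalD P Q q : reval (P + Q) q = reval P q + reval Q q.
Proof.
rewrite (reval_widen q (size_polyD P Q)).
rewrite (reval_widen q (leq_maxl (size P) (size Q))).
rewrite (reval_widen q (leq_maxr (size P) (size Q))) -big_split /=.
by apply: eq_bigr => i _; rewrite coefD mulrDr.
Qed.

Lemma reval0 q : reval 0 q = 0.
Proof. by rewrite /reval size_poly0 big_ord0. Qed.

(** Evaluation is not multiplicative in general. Coefficients stand to the right of the powers of q,
    so a constant factor on the right can be pulled out on that side. *)
Lemma revalMC P c q : reval (P * c%:P) q = reval P q * c.
Proof.
have [->|c0] := eqVneq c 0; first by rewrite mulr0 reval0 mulr0.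
have /reval_widen -> : (size (P * c%:P)%R <= size P)%N.
  by apply/leq_sizeP => j /leq_sizeP/(_ _ (leqnn _)); rewrite coefMC => ->;
    rewrite mul0r.
by rewrite /reval mulr_suml; apply: eq_bigr => i _; rewrite coefMC mulrA.
Qed.

Lemma revalMX P q : reval (P * 'X) q = q * reval P q.
Proof.
have /reval_widen -> : (size (P * 'X)%R <= (size P).+1)%N.
  by apply: leq_trans (size_polyMleq _ _) _; rewrite size_polyX addn2.
rewrite big_ord_recl coefMX mulr0 add0r mulr_sumr.
by apply: eq_bigr => i _; rewrite coefMX /= exprS mulrA.
Qed.

Lemma reval1 q : reval 1 q = 1.
Proof. by rewrite /reval size_poly1 big_ord1 expr0 mul1r coef1. Qed.

Lemma revalXn n q : reval 'X^n q = q ^+ n.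
Proof.
elim: n => [|n IH]; first by rewrite !expr0 reval1.
by rewrite exprSr revalMX IH exprS.
Qed.

Lemma regular_pow0 p q : regular_pow p 0 q = 1.
Proof. by rewrite /regular_pow expr0 reval1. Qed.

(** The factor ['X] acts by q on the left, the constant by p on the right, so the recursion is in
    general not multiplication by q - p. *)
Lemma regular_powS p n q :
  regular_pow p n.+1 q = q * regular_pow p n q - regular_pow p n q * p.
Proof.
by rewrite /regular_pow exprSr mulrBr -mulrN -polyCN revalD revalMX revalMC
  mulrN.
Qed.

Lemma regular_pow_norm p n q :
  `|regular_pow p n q| <= (`|q| + `|p|) ^+ n.
Proof.
elim: n => [|n IH]; first by rewrite regular_pow0 quat_norm1 expr0.
rewrite regular_powS exprS (le_trans (ler_normB _ _))// !quat_normM.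
by rewrite [X in _ + X]mulrC -mulrDl ler_wpM2l// addr_ge0.
Qed.

(* The indeterminate is central in {poly H}, so 'X - p%:P commutes with p%:P
   and the binomial formula holds even though p and q do not commute. *)
Lemma regular_binomial p n q :
  q ^+ n = \sum_(k < n.+1) regular_pow p k q * (p ^+ (n - k) *+ 'C(n, k)).
Proof.
have comm_p : GRing.comm p%:P ('X - p%:P).
  by apply: commrB => //; exact: commr_polyX.
rewrite -revalXn -[in LHS](subrKC p%:P 'X) (exprDn_comm _ comm_p).
rewrite (big_morph (fun P => reval P q) (fun P Q => revalD P Q q) (reval0 q)).
apply: eq_bigr => k _.
(* The power of p is moved to the right, where [revalMC] applies. *)
rewrite (commrX _ (commr_sym (commrX _ (commr_sym comm_p)))) -mulrnAr.
by rewrite -rmorphXn -polyCMn revalMC.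
Qed.

End RegularPower.

Section Recentering.
Variable R : realType.
Local Notation H := (quat R).

Lemma entire_abs_cvg (a : nat -> H) (r : R) : 0 <= r ->
    (forall q : H, cvgn (series (fun n => q ^+ n * a n))) ->
  cvgn (series (fun n => r ^+ n * `|a n|)).
Proof.
move=> r0 ha.
(* At the real point 2r the terms have norm at most some M, so those at r are at most M 2^-n. *)
have /cvg_series_cvg_0/cvgP/cvg_seq_bounded bnd := ha ((2 * r) *: (1 : H) : H).
have setT_pf := globally_properfilter (I : setT 0%N).
have [M Mle] := (ex_bound _).1 bnd.
have {}Mle n : (2 * r) ^+ n * `|a n| <= M.
  have := Mle n I; rewrite /= quat_normM quat_normX normrZ quat_norm1 mulr1.
  by rewrite ger0_norm// mulr_ge0.
apply: (series_le_cvg _ _ _ (@is_cvg_geometric_series _ M (2^-1) _))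
  => [n|n|n|].
- by rewrite mulr_ge0// exprn_ge0.
- rewrite /geometric /= mulr_ge0 ?exprn_ge0//.
  by apply: le_trans (Mle 0); rewrite expr0 mul1r.
- rewrite /geometric /= exprVn ler_pdivlMr ?exprn_gt0//.
  by rewrite mulrAC -exprMn [r * 2]mulrC.
- by rewrite ger0_norm// invf_lt1// ltr1n.
Qed.

(** For n < k the truncated difference [n - k] is 0, but the binomial coefficient vanishes, so the
    series over n may start at 0. *)
Definition recentered (a : nat -> H) (p : H) (k n : nat) : H :=
  (p ^+ (n - k) *+ 'C(n, k)) * a n.

(** Compare with the binomial expansion of (s + |p|)^n: a small N drops nonnegative terms, a large N
    adds only vanishing ones. Leaving [w] free covers both the regular powers and the constant 1. *)
Lemma recentered_sum_norm a p (w : nat -> H) (s : R) N n : 0 <= s ->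
    (forall k, `|w k| <= s ^+ k) ->
  \sum_(k < N) `|w k * recentered a p k n| <= (s + `|p|) ^+ n * `|a n|.
Proof.
move=> s0 ws.
pose F k := `|p| ^+ (n - k) * s ^+ k *+ 'C(n, k).
have F0 k : 0 <= F k by rewrite mulrn_wge0// mulr_ge0// exprn_ge0.
apply: (@le_trans _ _ (\sum_(k < N) F k * `|a n|)).
  apply: ler_sum => k _.
  rewrite /recentered !quat_normM normrMn quat_normX mulrA ler_wpM2r//.
  by rewrite mulrnAr lerMn2r mulrC ler_wpM2l ?exprn_ge0// orbT.
rewrite -mulr_suml ler_wpM2r// [s + _]addrC exprDn.
rewrite -[leRHS](big_mkord predT F) -(big_mkord predT F).
have [le_Nn|le_nN] := leqP N n.+1.
  by rewrite [leRHS](big_cat_nat (leq0n _) le_Nn)//= lerDl sumr_ge0.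
rewrite (big_cat_nat (leq0n _) (ltnW le_nN))//=.
rewrite [X in _ + X]big_nat [X in _ + X]big1 ?addr0//.
by move=> k /andP[lt_nk _]; rewrite /F bin_small// mulr0n.
Qed.

Lemma sum_recentered a p q N n : (n < N)%N ->
  \sum_(k < N) regular_pow p k q * recentered a p k n = q ^+ n * a n.
Proof.
move=> lt_nN; rewrite (regular_binomial p) mulr_suml.
pose F k := regular_pow p k q * recentered a p k n.
rewrite -(big_mkord predT F) (big_cat_nat (leq0n _) lt_nN)//=.
rewrite [X in _ + X]big_nat [X in _ + X]big1 ?addr0.
  by rewrite big_mkord; apply: eq_bigr => k _; rewrite /F /recentered mulrA.
move=> k /andP[lt_nk _].
by rewrite /F /recentered bin_small// mulr0n mul0r mulr0.
Qed.

Lemma recentered_cvg (a : nat -> H) (p : H) k :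
    (forall q : H, cvgn (series (fun n => q ^+ n * a n))) ->
  cvgn (series (recentered a p k)).
Proof.
move=> ha; apply: quat_normed_cvg.
apply: series_le_cvg (entire_abs_cvg (addr_ge0 ler01 (normr_ge0 p)) ha) => n //.
(* With [w] and s equal to 1, the sum over [k.+1] indices dominates its last term, that of index
   k. *)
apply: le_trans (recentered_sum_norm (w := fun=> 1) a p k.+1 n ler01 _).
  by rewrite big_ord_recr /= mul1r lerDr sumr_ge0.
by move=> j; rewrite quat_norm1 expr1n.
Qed.

End Recentering.

Theorem theorem5p7 (R : realType) (f : quat R -> quat R)
  (hf : quaternionic_entire f) :
  quaternionic_analytic [set: quat R] f.
Proof.
have [a fE] := hf; move=> p _.
have a_cvg q : cvgn (series (fun n => q ^+ n * a n)) by exact: cvgP (fE q).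
exists setT; split => //; first exact: filterT.
pose b k := limn (series (recentered a p k)); exists b => q _.
pose s : R := `|q| + `|p|.
have s0 : 0 <= s by rewrite addr_ge0.
pose A := series (fun n => (s + `|p|) ^+ n * `|a n|).
have A_cvg : cvgn A by apply: entire_abs_cvg => //; rewrite addr_ge0.
have A_homo : {homo A : m n / (m <= n)%N >-> m <= n}.
  apply/nondecreasing_seqP => n.
  by rewrite /A seriesSr lerDl mulr_ge0// exprn_ge0// addr_ge0.
(* For n < N the sum over k < N is all of q^n a_n, so only contributions with n >= N survive in the
   difference. *)
have tail N : `|series (fun k => regular_pow p k q * b k) N -
    series (fun n => q ^+ n * a n) N| <= limn A - A N.
  (* Truncating each [b k] at M leaves finite sums, which can be exchanged; the bound holds for all
     M >= N and passes to the limit. *)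
  pose S M := \sum_(0 <= k < N) regular_pow p k q * series (recentered a p k) M.
  have S_cvg : S @ \oo --> \sum_(0 <= k < N) regular_pow p k q * b k.
    apply: cvg_big => [|k _]; first exact: add_continuous.
    by apply: quat_cvgMl; exact/recentered_cvg.
  apply: (cvgr_to_le (cvg_norm (cvgB S_cvg (cvg_cst _)))).
  near=> M.
  have le_NM : (N <= M)%N by near: M; exact: nbhs_infty_ge.
  apply: (@le_trans _ _ (A M - A N)); last first.
    by rewrite lerD2r; exact: nondecreasing_cvgn_le.
  rewrite sub_series_geq// !fctE.
  have -> : S M = \sum_(0 <= n < M)
      \sum_(k < N) regular_pow p k q * recentered a p k n.
    rewrite /S big_mkord exchange_big /=; apply: eq_bigr => k _.
    by rewrite mulr_sumr.
  rewrite (big_cat_nat (leq0n _) le_NM)//= addrC addrA.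
  rewrite {1}/series /= [X in - X + _](eq_big_nat _ _ (F2 := fun n =>
    \sum_(k < N) regular_pow p k q * recentered a p k n)); last first.
    by move=> n /andP[_ lt_nN]; rewrite sum_recentered.
  rewrite addNr add0r (le_trans (ler_norm_sum _ _ _))// ler_sum// => n _.
  apply: le_trans (ler_norm_sum _ _ _) _.
  pose w k := regular_pow p k q.
  apply: (recentered_sum_norm (w := w) a p N n s0) => k; exact: regular_pow_norm.
rewrite -[f q]add0r.
(* The partial sums are those of the series of f plus a difference that [tail] squeezes to 0. *)
have -> : series (fun k => regular_pow p k q * b k) =
    (fun N => series (fun k => regular_pow p k q * b k) N -
      series (fun n => q ^+ n * a n) N) + series (fun n => q ^+ n * a n).
  by apply/funext => N; rewrite /= !fctE subrK.
apply: cvgD; last exact: fE.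
apply/norm_cvg0P.
apply: (@squeeze_cvgr _ _ _ _ (cst 0) (fun N => limn A - A N)).
- by near=> N; rewrite normr_ge0 tail.
- exact: cvg_cst.
- by rewrite -(subrr (limn A)); apply: cvgB => //; exact: cvg_cst.
Unshelve. all: by end_near. Qed.
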